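(* Let $(M,d)$ be a metric space with a distinguished point $0\in M$ and let $f\in \mathrm{Lip}_0(M,M)$. If $M$ is countable and radially discrete with respect to $0$, then the following assertions are equivalent: \begin{enumerate} \item $T_f$ is hypercyclic on $\mathcal F(M)$; \item $T_f$ is weakly mixing on $\mathcal F(M)$; \item $f$ has the targeting property around $0\in M$. \end{enumerate}
   Context: For a metric space $(M,d)$ with distinguished point $0$, $\mathrm{Lip}_0(M)$ is the real Banach space of Lipschitz functions $g\colon M\to\mathbb R$ with $g(0)=0$, normed by the Lipschitz constant. For $x\in M$, $\delta_x\in \mathrm{Lip}_0(M)^*$ is evaluation at $x$. The Lipschitz-free space is $\mathcal F(M)=\overline{\operatorname{span}}\{\delta_x:x\in M\}\subset \mathrm{Lip}_0(M)^*$ (dual norm closure). $\mathrm{Lip}_0(M,M)$ is the set of Lipschitz maps $f\colon M\to M$ with $f(0)=0$; for such $f$, $T_f\colon\mathcal F(M)\to\mathcal F(M)$ is the unique bounded linear operator with $T_f(\delta_x)=\delta_{f(x)}$ for all $x\in M$. $M$ is radially discrete with respect to $x_0\in M$ if there exists $K\ge1$ such that $d(x,x_0)\le K\,d(x,y)$ for all $x\neq y$ in $M$. A continuous map $f\colon M\to M$ with $f(x_0)=x_0$ has the targeting property around $x_0$ if for every $\varepsilon>0$ and every finite $F\subset M$ there is $n\in\mathbb N$ ($n\ge1$) such that for every $x,y\in F$: (i) there exist $u,u_0\in M$ with $\max\{d(u,x),d(u_0,x_0),d(f^n(u),f^n(u_0))\}<\varepsilon$; and (ii) there exist $v,v_0\in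 M$ with $\max\{d(v,v_0),d(f^n(v),y),d(f^n(v_0),x_0)\}<\varepsilon$. An operator $T$ is hypercyclic if it has a dense orbit $\{T^n x:n\ge0\}$, and weakly mixing if $T\times T$ is topologically transitive. *)

(* Defs.v *)
From HB Require Import structures.
From mathcomp Require Import all_boot all_order all_algebra.
From mathcomp Require Import all_classical all_reals all_analysis.
From mathcomp Require Import ring lra.

Set Implicit Arguments.
Unset Strict Implicit.
Unset Printing Implicit Defensive.

Import Order.TTheory GRing.Theory Num.Theory.
Import numFieldNormedType.Exports.

Local Open Scope classical_set_scope.
Local Open Scope ring_scope.

Section LinearSpan.
Context {R : realType} {V : lmodType R}.

Definition lspan (A : set V) : set V :=
  [set v | exists (n : nat) (a : 'I_n -> R) (w : 'I_n -> V),
     (forall i, A (w i)) /\ v = \sum_(i < n) a i *: w i].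

Lemma lspan0 A : lspan A 0.
Proof.
exists 0%N, (fun=> 0), (fun=> 0); split; first by case.
by rewrite big_ord0.
Qed.

Lemma sub_lspan A : A `<=` lspan A.
Proof.
move=> v Av; exists 1%N, (fun=> 1), (fun=> v); split=> //.
by rewrite big_ord1 scale1r.
Qed.

Lemma lspanZD A (c : R) u v : lspan A u -> lspan A v -> lspan A (c *: u + v).
Proof.
move=> [m [a [w [Aw ->]]]] [n [b [z [Az ->]]]].
exists (m + n)%N,
  (fun i => match fintype.split i with inl j => c * a j | inr j => b j end),
  (fun i => match fintype.split i with inl j => w j | inr j => z j end); split.
  by move=> i; case: fintype.split.
rewrite big_split_ord scaler_sumr /=; congr (_ + _); apply: eq_bigr => i _.
  by have /= -> := unsplitK (inl i : 'I_m + 'I_n); rewrite scalerA.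
by have /= -> := unsplitK (inr i : 'I_m + 'I_n).
Qed.

End LinearSpan.

Lemma closure_normP {R : realType} {V : normedModType R} (A : set V) v :
  closure A v <-> forall e : R, 0 < e -> exists2 u, A u & `|v - u| < e.
Proof.
split=> [clA e e0|h B /nbhs_normP[e /= e0 eB]].
  have /clA[u [Au]] : nbhs v (ball v e) by exact: nbhsx_ballx.
  by rewrite -ball_normE /= => ?; exists u.
by have [u Au uv] := h e e0; exists u; split=> //; exact: eB.
Qed.

Section Dual.
Context {R : realType} (V : normedModType R).

Definition is_dual : {pred V -> R} :=
  fun phi => `[< linear phi /\ continuous phi >].

Lemma is_dual_submod_closed : submod_closed is_dual.
Proof.
split=> [|c phi psi /asboolP[lphi cphi] /asboolP[lpsi cpsi]]; apply/asboolP.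
  split=> [a u v|]; first by rewrite /= scaler0 addr0.
  exact: cst_continuous.
split=> [a u v|v].
  change (c * phi (a *: u + v) + psi (a *: u + v) =
          a * (c * phi u + psi u) + (c * phi v + psi v)).
  rewrite lphi lpsi.
  change (c * (a * phi u + phi v) + (a * psi u + psi v) =
          a * (c * phi u + psi u) + (c * phi v + psi v)).
  by ring.
apply: continuousD; last exact: cpsi.
by apply: continuousZl_tmp; exact: cphi.
Qed.

HB.instance Definition _ :=
  GRing.isSubmodClosed.Build R (V -> R) is_dual is_dual_submod_closed.

Record cdual := CDual { dual_fun :> V -> R; dual_funP : dual_fun \in is_dual }.

HB.instance Definition _ := [isSub for dual_fun].
HB.instance Definition _ := [Choice of cdual by <:].
HB.instance Definition _ := [SubChoice_isSubLmodule of cdual by <:].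

Lemma dual_linear (phi : cdual) : linear phi.
Proof. by have /asboolP[] := dual_funP phi. Qed.

Lemma dual_continuous (phi : cdual) : continuous phi.
Proof. by have /asboolP[] := dual_funP phi. Qed.

HB.instance Definition _ (phi : cdual) :=
  GRing.isLinear.Build R V R _ phi (@dual_linear phi).

Lemma dual_eqP (phi psi : cdual) : (forall v, phi v = psi v) -> phi = psi.
Proof. by move=> e; apply/val_inj/funext. Qed.

Lemma dualDE (phi psi : cdual) v : (phi + psi) v = phi v + psi v.
Proof. by []. Qed.

Lemma dualNE (phi : cdual) v : (- phi) v = - phi v.
Proof. by []. Qed.

Lemma dualZE c (phi : cdual) v : (c *: phi) v = c * phi v.
Proof. by []. Qed.

Lemma dual0E v : (0 : cdual) v = 0.
Proof. by []. Qed.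

Definition opnorm (phi : cdual) : R :=
  sup [set `|phi v| | v in [set v : V | `|v| <= 1]].

Lemma opnorm_has_sup (phi : cdual) :
  has_sup [set `|phi v| | v in [set v : V | `|v| <= 1]].
Proof.
split; first by exists `|phi 0|, 0 => //=; rewrite normr0.
have /linear_bounded_continuous/bounded_funP/(_ 1)[k hk] :=
  @dual_continuous phi.
by exists k => _ [v /= v1 <-]; exact: hk.
Qed.

Lemma opnorm_ge0 phi : 0 <= opnorm phi.
Proof.
apply: (le_trans (normr_ge0 (phi 0))).
apply: sup_upper_bound; first exact: opnorm_has_sup.
by exists 0 => //=; rewrite normr0.
Qed.

Lemma opnormP (phi : cdual) v : `|phi v| <= opnorm phi * `|v|.
Proof.
have [->|v0] := eqVneq v 0; first by rewrite linear0 !normr0 mulr0.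
have v_gt0 : 0 < `|v| by rewrite normr_gt0.
rewrite -ler_pdivrMr// -[X in _ / X]ger0_norm// -normfV mulrC -normrM.
rewrite -[_ * _]/(`|v|^-1 *: phi v) -linearZ /=.
apply: sup_upper_bound; first exact: opnorm_has_sup.
exists (`|v|^-1 *: v) => //=.
by rewrite normrZ normfV normr_id mulVf// gt_eqF.
Qed.

Lemma opnorm_le (phi : cdual) k :
  0 <= k -> (forall v, `|phi v| <= k * `|v|) -> opnorm phi <= k.
Proof.
move=> k0 h; apply: ge_sup; first by case: (opnorm_has_sup phi).
move=> _ [v /= v1 <-]; apply: (le_trans (h v)).
by rewrite -[leRHS]mulr1 ler_wpM2l.
Qed.

Lemma opnormD phi psi : opnorm (phi + psi) <= opnorm phi + opnorm psi.
Proof.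
apply: opnorm_le => [|v]; first by rewrite addr_ge0 ?opnorm_ge0.
rewrite dualDE mulrDl (le_trans (ler_normD _ _))// lerD//; exact: opnormP.
Qed.

Lemma opnormZ c phi : opnorm (c *: phi) = `|c| * opnorm phi.
Proof.
apply/eqP; rewrite eq_le; apply/andP; split.
  apply: opnorm_le => [|v]; first by rewrite mulr_ge0 ?opnorm_ge0.
  by rewrite dualZE normrM -mulrA ler_wpM2l// opnormP.
have [->|c0] := eqVneq c 0; first by rewrite normr0 mul0r opnorm_ge0.
rewrite mulrC -ler_pdivlMr ?normr_gt0//; apply: opnorm_le => [|v].
  by rewrite divr_ge0 ?opnorm_ge0.
rewrite mulrAC ler_pdivlMr ?normr_gt0// mulrC -normrM -dualZE.
exact: opnormP.
Qed.

Lemma opnorm0_eq0 phi : opnorm phi = 0 -> phi = 0.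
Proof.
move=> h; apply: dual_eqP => v; apply/eqP; rewrite dual0E -normr_le0.
by rewrite -(mul0r `|v|) -h opnormP.
Qed.

HB.instance Definition _ :=
  @Lmodule_isNormed.Build R cdual opnorm opnormD opnormZ opnorm0_eq0.

Lemma dual_normE (phi : cdual) : `|phi| = opnorm phi.
Proof. by []. Qed.

End Dual.

Section Lip0.
Context {R : realType} {M : metricType R} (o : M).

Definition lip0 : {pred M -> R} := fun g =>
  `[< g o = 0 /\ exists k, forall x y, `|g x - g y| <= k * mdist x y >].

Lemma lip0_submod_closed : submod_closed lip0.
Proof.
split=> [|c g h /asboolP[g0 [k gk]] /asboolP[h0 [l hl]]]; apply/asboolP.
  split=> //; exists 0 => x y.
  by rewrite /GRing.zero /= subrr normr0 mul0r.
split; first by rewrite /GRing.add /GRing.scale /= g0 h0 scaler0 addr0.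
exists (`|c| * k + l) => x y.
change (`|c * g x + h x - (c * g y + h y)| <= (`|c| * k + l) * mdist x y).
rewrite opprD addrACA -mulrBr mulrDl (le_trans (ler_normD _ _))// lerD//.
by rewrite normrM -mulrA ler_wpM2l.
Qed.

HB.instance Definition _ :=
  GRing.isSubmodClosed.Build R (M -> R) lip0 lip0_submod_closed.

Record Lip0 := MkLip0 { Lip0_fun :> M -> R; Lip0_funP : Lip0_fun \in lip0 }.

HB.instance Definition _ := [isSub for Lip0_fun].
HB.instance Definition _ := [Choice of Lip0 by <:].
HB.instance Definition _ := [SubChoice_isSubLmodule of Lip0 by <:].

Lemma Lip0_base (g : Lip0) : g o = 0.
Proof. by have /asboolP[] := Lip0_funP g. Qed.

Lemma Lip0_lip (g : Lip0) :
  exists k, forall x y, `|g x - g y| <= k * mdist x y.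
Proof. by have /asboolP[] := Lip0_funP g. Qed.

Lemma Lip0_eqP (g h : Lip0) : (forall x, g x = h x) -> g = h.
Proof. by move=> e; apply/val_inj/funext. Qed.

Lemma Lip0DE (g h : Lip0) x : (g + h) x = g x + h x.
Proof. by []. Qed.

Lemma Lip0NE (g : Lip0) x : (- g) x = - g x.
Proof. by []. Qed.

Lemma Lip0ZE c (g : Lip0) x : (c *: g) x = c * g x.
Proof. by []. Qed.

Lemma Lip00E x : (0 : Lip0) x = 0.
Proof. by []. Qed.

Definition lipnorm (g : Lip0) : R :=
  inf [set k | 0 <= k /\ forall x y, `|g x - g y| <= k * mdist x y].

Lemma lipnorm_has_inf (g : Lip0) :
  has_inf [set k | 0 <= k /\ forall x y, `|g x - g y| <= k * mdist x y].
Proof.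
split; last by exists 0 => k [].
have [k gk] := Lip0_lip g; exists `|k|; split=> // x y.
by rewrite (le_trans (gk x y))// ler_wpM2r ?mdist_ge0 ?ler_norm.
Qed.

Lemma lipnorm_ge0 g : 0 <= lipnorm g.
Proof. by apply: lb_le_inf => [|k []//]; case: (lipnorm_has_inf g). Qed.

Lemma lipnormP (g : Lip0) x y : `|g x - g y| <= lipnorm g * mdist x y.
Proof.
have [->|xy] := eqVneq x y; first by rewrite subrr normr0 mdistxx mulr0.
have xy0 : 0 < mdist x y by rewrite mdist_gt0.
rewrite -ler_pdivrMr//; apply: lb_le_inf; first by case: (lipnorm_has_inf g).
by move=> k [_ gk]; rewrite ler_pdivrMr.
Qed.

Lemma lipnorm_le (g : Lip0) k : 0 <= k ->
  (forall x y, `|g x - g y| <= k * mdist x y) -> lipnorm g <= k.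
Proof. by move=> k0 gk; apply: ge_inf; first by exists 0 => l []. Qed.

Lemma lipnormD g h : lipnorm (g + h) <= lipnorm g + lipnorm h.
Proof.
apply: lipnorm_le => [|x y]; first by rewrite addr_ge0 ?lipnorm_ge0.
rewrite !Lip0DE opprD addrACA mulrDl (le_trans (ler_normD _ _))// lerD//;
  exact: lipnormP.
Qed.

Lemma lipnormZ c g : lipnorm (c *: g) = `|c| * lipnorm g.
Proof.
apply/eqP; rewrite eq_le; apply/andP; split.
  apply: lipnorm_le => [|x y]; first by rewrite mulr_ge0 ?lipnorm_ge0.
  by rewrite !Lip0ZE -mulrBr normrM -mulrA ler_wpM2l// lipnormP.
have [->|c0] := eqVneq c 0; first by rewrite normr0 mul0r lipnorm_ge0.
rewrite mulrC -ler_pdivlMr ?normr_gt0//; apply: lipnorm_le => [|x y].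
  by rewrite divr_ge0 ?lipnorm_ge0.
rewrite mulrAC ler_pdivlMr ?normr_gt0// mulrC -normrM mulrBr -!Lip0ZE.
exact: lipnormP.
Qed.

Lemma lipnorm0_eq0 g : lipnorm g = 0 -> g = 0.
Proof.
move=> h; apply: Lip0_eqP => x; rewrite Lip00E; apply/eqP.
by rewrite -normr_le0; have := lipnormP g x o; rewrite h mul0r Lip0_base subr0.
Qed.

HB.instance Definition _ :=
  @Lmodule_isNormed.Build R Lip0 lipnorm lipnormD lipnormZ lipnorm0_eq0.

Lemma Lip0_normE (g : Lip0) : `|g| = lipnorm g.
Proof. by []. Qed.

Lemma eval_is_dual (x : M) : (fun g : Lip0 => g x) \in @is_dual R Lip0.
Proof.
have lin : linear (fun g : Lip0 => g x) by [].
apply/asboolP; split=> //.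
pose ev : {linear Lip0 -> R} :=
  HB.pack (fun g : Lip0 => g x) (GRing.isLinear.Build R Lip0 R _ _ lin).
apply: (@bounded_linear_continuous _ _ _ ev); apply/bounded_funP => r.
exists (r * mdist x o) => g gr /=.
rewrite -[g x]subr0 -(Lip0_base g) (le_trans (lipnormP g x o))//.
by rewrite ler_wpM2r ?mdist_ge0.
Qed.

Definition eval (x : M) : cdual Lip0 := CDual (eval_is_dual x).

Definition free_pred : {pred cdual Lip0} :=
  fun phi => `[< closure (lspan (range eval)) phi >].

Lemma free_submod_closed : submod_closed free_pred.
Proof.
split=> [|c phi psi /asboolP/closure_normP hphi /asboolP/closure_normP hpsi].
  by apply/asboolP/subset_closure/lspan0.
apply/asboolP/closure_normP => e e0.
have d0 : 0 < e / 2 / (`|c| + 1) by rewrite !divr_gt0// ltr_pwDr.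
have [phi' sphi' phi'e] := hphi _ d0.
have [psi' spsi' psi'e] := hpsi (e / 2) (divr_gt0 e0 (ltr0n _ 2)).
exists (c *: phi' + psi'); first exact: lspanZD.
rewrite opprD addrACA -scalerBr (le_lt_trans (ler_normD _ _))//.
rewrite [ltRHS]splitr ler_ltD// normrZ.
move: phi'e; rewrite ltr_pdivlMr ?ltr_pwDr// => /ltW; apply: le_trans.
by rewrite mulrC ler_wpM2l// lerDl.
Qed.

HB.instance Definition _ := GRing.isSubmodClosed.Build R (cdual Lip0)
  free_pred free_submod_closed.

(* F(M) with the norm inherited from the dual of Lip_0(M) *)
Record freespace := Freespace {
  free_val :> cdual Lip0;
  free_valP : free_val \in free_pred }.

HB.instance Definition _ := [isSub for free_val].
HB.instance Definition _ := [Choice of freespace by <:].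
HB.instance Definition _ := [SubChoice_isSubLmodule of freespace by <:].

Definition free_norm (u : freespace) : R := `|free_val u|.

Lemma free_normD u v : free_norm (u + v) <= free_norm u + free_norm v.
Proof. exact: ler_normD. Qed.

Lemma free_normZ c u : free_norm (c *: u) = `|c| * free_norm u.
Proof. exact: normrZ. Qed.

Lemma free_norm0_eq0 u : free_norm u = 0 -> u = 0.
Proof. by move/normr0_eq0 => u0; apply/val_inj. Qed.

HB.instance Definition _ :=
  @Lmodule_isNormed.Build R freespace free_norm free_normD free_normZ free_norm0_eq0.

Lemma free_normE (u : freespace) : `|u| = `|free_val u|.
Proof. by []. Qed.

Lemma delta_in_free (x : M) : eval x \in free_pred.
Proof. by apply/asboolP/subset_closure/sub_lspan; exists x. Qed.

Definition delta (x : M) : freespace := Freespace (delta_in_free x).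

Lemma lspan_delta_dense (u : freespace) (e : R) : 0 < e ->
  exists2 v, lspan (range delta) v & `|u - v| < e.
Proof.
move=> e0.
have /asboolP/closure_normP/(_ e e0)[_ [n [a [w [dw ->]]]] uw] := free_valP u.
have /choice[z zw] : forall i, exists x, eval x = w i.
  by move=> i; have [x _ <-] := dw i; exists x.
exists (\sum_(i < n) a i *: delta (z i)).
  by exists n, a, (delta \o z); split=> // i; exists (z i).
rewrite free_normE; congr (`|_| < e): uw.
have -> : free_val (u - \sum_(i < n) a i *: delta (z i)) =
  free_val u - free_val (\sum_(i < n) a i *: delta (z i)) by [].
congr (_ - _); have -> : free_val (\sum_(i < n) a i *: delta (z i)) =
  \sum_(i < n) free_val (a i *: delta (z i)).
  by apply: (big_morph free_val (id1 := 0) (op1 := +%R)).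
by apply: eq_bigr => i _; rewrite -zw.
Qed.

Record Lip0_self := MkLip0_self {
  Lip0_self_fun :> M -> M;
  Lip0_self_base : Lip0_self_fun o = o;
  Lip0_self_lip : exists k : R, forall x y,
    mdist (Lip0_self_fun x) (Lip0_self_fun y) <= k * mdist x y }.

Section Linearization.
Variable f : Lip0_self.

Lemma precomp_lip0 (g : Lip0) : (fun x => g (f x)) \in lip0.
Proof.
apply/asboolP; split; first by rewrite Lip0_self_base Lip0_base.
have [k fk] := Lip0_self_lip f.
exists (`|g| * k) => x y; rewrite (le_trans (lipnormP g _ _))// -mulrA.
by rewrite ler_wpM2l ?lipnorm_ge0.
Qed.

Definition precomp (g : Lip0) : Lip0 := MkLip0 (precomp_lip0 g).

Lemma precomp_bounded :
  exists2 k : R, 0 <= k & forall g, `|precomp g| <= k * `|g|.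
Proof.
have [k fk] := Lip0_self_lip f; exists `|k| => // g.
apply: lipnorm_le => [|x y]; first by rewrite mulr_ge0.
rewrite /= (le_trans (lipnormP g _ _))// mulrAC mulrC ler_wpM2r ?lipnorm_ge0//.
by rewrite (le_trans (fk x y))// ler_wpM2r ?mdist_ge0 ?ler_norm.
Qed.

Lemma adjoint_is_dual (phi : cdual Lip0) :
  (fun g => phi (precomp g)) \in @is_dual R Lip0.
Proof.
have lin : linear (fun g => phi (precomp g)).
  by move=> a g h; rewrite -(dual_linear phi); congr (phi _); exact: Lip0_eqP.
apply/asboolP; split=> //.
pose ev : {linear Lip0 -> R} :=
  HB.pack (fun g => phi (precomp g)) (GRing.isLinear.Build R Lip0 R _ _ lin).
have [k k0 fk] := precomp_bounded.
apply: (@bounded_linear_continuous _ _ _ ev); apply/bounded_funP => r.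
exists (`|phi| * (k * r)) => g gr /=.
rewrite (le_trans (opnormP phi _))// ler_wpM2l ?opnorm_ge0//.
by rewrite (le_trans (fk g))// ler_wpM2l.
Qed.

Definition adjoint (phi : cdual Lip0) : cdual Lip0 := CDual (adjoint_is_dual phi).

Lemma adjoint_bounded :
  exists2 k : R, 0 <= k & forall phi, `|adjoint phi| <= k * `|phi|.
Proof.
have [k k0 fk] := precomp_bounded; exists k => // phi.
apply: opnorm_le => [|g]; first by rewrite mulr_ge0.
rewrite /= (le_trans (opnormP phi _))// -dual_normE [leRHS]mulrAC [leRHS]mulrC.
by rewrite ler_wpM2l.
Qed.

Lemma adjoint_linear : linear adjoint.
Proof. by move=> a phi psi; exact: dual_eqP. Qed.

HB.instance Definition _ :=
  GRing.isLinear.Build R (cdual Lip0) (cdual Lip0) _ adjoint adjoint_linear.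

Lemma adjoint_eval x : adjoint (eval x) = eval (f x).
Proof. exact: dual_eqP. Qed.

Lemma adjoint_free (u : freespace) : adjoint u \in free_pred.
Proof.
apply/asboolP/closure_normP => e e0.
have [k k0 ak] := adjoint_bounded.
have d0 : 0 < e / (k + 1) by rewrite divr_gt0// ltr_pwDr.
have /asboolP/closure_normP/(_ _ d0)[_ [n [a [w [dw ->]]]] uw] := free_valP u.
exists (\sum_(i < n) a i *: adjoint (w i)).
  exists n, a, (adjoint \o w); split=> // i /=.
  by have [x _ <-] := dw i; exists (f x) => //; rewrite adjoint_eval.
under eq_bigr do rewrite -linearZ.
rewrite -linear_sum -linearB (le_lt_trans (ak _))//.
move: uw; rewrite ltr_pdivlMr ?ltr_pwDr//; apply: le_lt_trans.
by rewrite mulrC ler_wpM2l// lerDl.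
Qed.

Lemma linearization_exists_unique :
  exists! T : freespace -> freespace,
    [/\ linear T, continuous T & forall x, T (delta x) = delta (f x)].
Proof.
pose T (u : freespace) : freespace := Freespace (adjoint_free u).
have Tlin : linear T.
  by move=> a u v; apply/val_inj; rewrite /= -adjoint_linear.
exists T; split.
  split=> //.
    pose T' : {linear freespace -> freespace} :=
      HB.pack T (GRing.isLinear.Build R freespace freespace _ _ Tlin).
    apply: (@bounded_linear_continuous _ _ _ T'); apply/bounded_funP => r.
    have [k k0 ak] := adjoint_bounded.
    exists (k * r) => u ur; rewrite free_normE (le_trans (ak _))//.
    by rewrite ler_wpM2l.
  by move=> x; apply/val_inj; rewrite /= adjoint_eval.
move=> S [Slin Scont Sdelta].
have Tdelta x : T (delta x) = delta (f x).
  by apply/val_inj; rewrite /= adjoint_eval.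
pose T' : {linear freespace -> freespace} :=
  HB.pack T (GRing.isLinear.Build R freespace freespace _ _ Tlin).
pose S' : {linear freespace -> freespace} :=
  HB.pack S (GRing.isLinear.Build R freespace freespace _ _ Slin).
apply/funext => u; apply/eqP; rewrite -subr_eq0 -normr_le0.
apply/ler_addgt0Pl => e e0; rewrite addr0.
have [k k0 ak] := adjoint_bounded.
have e20 : 0 < e / 2 by rewrite divr_gt0.
have /cvgrPdist_lt/(_ _ e20)/nbhs_normP[d /= d0 Sd] := Scont u.
have m0 : 0 < Num.min d (e / 2 / (k + 1)).
  by rewrite lt_min d0 !divr_gt0// ltr_pwDr.
have [_ [n [a [w [dw ->]]]]] := lspan_delta_dense u m0.
set v := \sum_(i < n) _; rewrite lt_min => /andP[uvd uve].
have TSv : T v = S v.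
  rewrite -[T]/(T' : _ -> _) -[S]/(S' : _ -> _) !linear_sum.
  apply: eq_bigr => i _; rewrite !linearZ /=.
  by have [x _ <-] := dw i; rewrite Tdelta Sdelta.
rewrite -(subrKA (T v)) {2}TSv (le_trans (ler_normD _ _))// [leRHS]splitr.
rewrite lerD//; last by rewrite distrC; apply/ltW/Sd.
rewrite -[T]/(T' : _ -> _) -linearB /=.
rewrite free_normE (le_trans (ak _))// -free_normE.
move: uve; rewrite ltr_pdivlMr ?ltr_pwDr// => /ltW; apply: le_trans.
by rewrite mulrC ler_wpM2l// lerDl.
Qed.

(* The operator T_f on F(M) *)
Definition linearization : freespace -> freespace :=
  sval (cid linearization_exists_unique).

Lemma linearizationP :
  [/\ linear linearization, continuous linearization &
      forall x, linearization (delta x) = delta (f x)].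
Proof. by rewrite /linearization; case: cid => T []. Qed.

Lemma linearization_unique (T : freespace -> freespace) :
  linear T -> continuous T -> (forall x, T (delta x) = delta (f x)) ->
  T = linearization.
Proof.
move=> Tlin Tcont Td; rewrite /linearization; case: cid => S /= [_ uS].
by apply/esym/uS.
Qed.

End Linearization.

End Lip0.

Section MetricNotions.
Context {R : realType} {M : metricType R}.

Definition radially_discrete (x0 : M) : Prop :=
  exists2 K : R, 1 <= K &
    forall x y : M, x <> y -> mdist x x0 <= K * mdist x y.

(* A condition on maps that are assumed continuous with [f x0 = x0]; both hold
   for elements of [Lip0_self x0]. *)
Definition targeting (f : M -> M) (x0 : M) : Prop :=
  forall (e : R) (F : set M), 0 < e -> finite_set F ->
  exists2 n : nat, (1 <= n)%N & forall x y, F x -> F y ->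
    (exists u u0 : M,
      [/\ mdist u x < e, mdist u0 x0 < e &
           mdist (iter n f u) (iter n f u0) < e]) /\
    (exists v v0 : M,
      [/\ mdist v v0 < e, mdist (iter n f v) y < e &
           mdist (iter n f v0) x0 < e]).

End MetricNotions.

Definition hypercyclic {E : topologicalType} (T : E -> E) : Prop :=
  exists x : E, dense (range (fun n => iter n T x)).

Definition topologically_transitive {E : topologicalType} (T : E -> E) : Prop :=
  forall U V : set E, open U -> U !=set0 -> open V -> V !=set0 ->
  exists n : nat, ([set iter n T x | x in U] `&` V) !=set0.

Definition weakly_mixing {E : topologicalType} (T : E -> E) : Prop :=
  topologically_transitive (fun p : E * E => (T p.1, T p.2)).

(* Main.v *)
(* Kitai's criterion gives targeting => weakly mixing: targeting provides, for
   each delta_x, a nearby vector that T_f^n sends close to 0 and a small vector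
   that T_f^n sends close to delta_x, and both properties survive linear
   combinations.  Birkhoff's transitivity theorem gives weakly mixing =>
   hypercyclic, as F(M) is complete and, M being countable, separable.

   For hypercyclic => targeting let A be the sum of the delta_x for x in F.
   Density of an orbit and linearity give a close to A with T_f^n a close to -A.
   By radial discreteness the indicator h of a point z at distance at least r
   from 0 is Lipschitz, and so is h o f^n if all preimages of z under f^n are at
   distance at least r from 0, both with constant at most K / r.  Pairing
   a with h o f^n then shows that A(h o f^n) and -A(h) nearly agree, although
   both A(h o f^n) and A(h) are nonnegative integers.  Hence they vanish, so z
   lies neither in F nor in f^n(F).  In other words every z of F or f^n(F) away
   from 0 has a preimage under f^n close to 0, which is targeting. *)
From HB Require Import structures.
Require Import Defs.
From mathcomp Require Import all_boot all_order all_algebra.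
From mathcomp Require Import all_classical all_reals all_analysis.
From mathcomp Require Import ring lra.

Set Implicit Arguments.
Unset Strict Implicit.
Unset Printing Implicit Defensive.

Import Order.TTheory GRing.Theory Num.Theory.
Import numFieldNormedType.Exports.

Local Open Scope classical_set_scope.
Local Open Scope ring_scope.

(** * Iteration, transitivity and dense orbits *)

Lemma iter_continuous (E : topologicalType) (T : E -> E) n :
  continuous T -> continuous (iter n T).
Proof.
move=> Tc; elim: n => [|n IHn] x; first exact: cvg_id.
exact: (continuous_comp (IHn x) (Tc _)).
Qed.

Lemma iter_linear (R : nzRingType) (V : lmodType R) (T : V -> V) n :
  linear T -> linear (iter n T).
Proof. by move=> Tl; elim: n => [|n IHn] a u v //=; rewrite IHn Tl. Qed.

Lemma iter_pair (E : Type) (T : E -> E) n p :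
  iter n (fun p : E * E => (T p.1, T p.2)) p = (iter n T p.1, iter n T p.2).
Proof. by elim: n => [|n /= ->] //; case: p. Qed.

Lemma open_prod_norm (R : realType) (V : normedModType R) (U : set (V * V))
    a b :
  open U -> U (a, b) ->
  exists2 e : R, 0 < e &
    forall p q, `|p - a| < e -> `|q - b| < e -> U (p, q).
Proof.
move=> oU Uab; have /= := open_nbhs_nbhs (conj oU Uab).
case=> [[P Q] [/nbhs_normP[d /= d0 dP] /nbhs_normP[d' /= d'0 dQ]] PQU].
exists (Num.min d d'); first by rewrite lt_min d0.
move=> p q; rewrite !lt_min => /andP[pd _] /andP[_ qd'].
by apply: PQU; split; [apply: dP|apply: dQ]; rewrite /= distrC.
Qed.

Lemma weakly_mixing_transitive (E : topologicalType) (T : E -> E) :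
  weakly_mixing T -> topologically_transitive T.
Proof.
move=> wT U V oU [u Uu] oV [v Vv].
have open_fst (A : set E) : open A -> open (@fst E E @^-1` A).
  by move=> oA; apply: open_comp => // p _; exact: cvg_fst.
have [||n [_ [[p Up <-]]]] :=
  wT _ _ (open_fst _ oU) _ (open_fst _ oV) _;
  [by exists (u, u)|by exists (v, v)|].
by rewrite iter_pair => Vp; exists n, (iter n T p.1); split => //; exists p.1.
Qed.

(** A Baire category argument: for each ball of a countable base, the points whose orbit meets it
    form an open set, dense by transitivity. A point common to all these sets has a dense orbit. *)
Theorem birkhoff_transitivity (R : realType) (E : completeNormedModType R)
    (T : E -> E) (J : countType) (D : J -> E) :
  (forall u (e : R), 0 < e -> exists i, `|u - D i| < e) ->
  continuous T -> topologically_transitive T -> hypercyclic T.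
Proof.
move=> denseD Tc Ttr.
pose B (j : J * nat) : set E := ball (D j.1) j.2.+1%:R^-1.
have oB j : open (B j) by exact: ball_open.
(* [Baire] wants a family indexed by [nat]; numbers that code no pair contribute the whole space. *)
pose G k : set E :=
  if unpickle k is Some j then \bigcup_n (iter n T @^-1` B j) else setT.
have oG k : open (G k) /\ dense (G k).
  rewrite /G; case: unpickle => [j|]; last first.
    by split; [exact: openT|move=> U [u Uu] _; exists u].
  split.
    apply: bigcup_open => n _; apply: open_comp => // x _.
    exact: iter_continuous.
  move=> U U0 oU; have [|n [_ [[x Ux <-] Bx]]] := Ttr U _ oU U0 (oB j).
    by exists (D j.1); exact: ballxx.
  by exists x; split => //; exists n.
have [|x [_ Gx]] := Baire oG _ openT; first by exists point.
exists x => U [u Uu] oU.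
have /nbhs_normP[e /= e0 eU] := open_nbhs_nbhs (conj oU Uu).
have e20 : 0 < e / 2 by rewrite divr_gt0.
have [m me] : exists m : nat, m.+1%:R^-1 < e / 2.
  have [m _ /(_ m (leqnn _))/=] := near_infty_natSinv_lt (PosNum e20).
  by exists m.
have [i ui] := denseD u _ e20.
have := Gx (pickle (i, m)) I; rewrite /G pickleK => -[n _ Bn].
exists (iter n T x); split; last by exists n.
apply: eU; rewrite /= -(subrKA (D i)) (le_lt_trans (ler_normD _ _))//.
rewrite [e]splitr ltrD//; move: Bn; rewrite /B /= -ball_normE /= => /lt_trans.
exact.
Qed.

(** The orbit of [x] comes near [A] at some time [n] and near [- A] at some time [m]. If [m < n],
    the order is reversed by linearity: start from [- iter m T x], which is near [A] and reaches
    [- iter n T x]. *)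
Lemma hypercyclic_to_opposite (R : realType) (V : normedModType R)
    (T : V -> V) (A : V) (e : R) :
  linear T -> hypercyclic T -> 0 < e ->
  exists n a, `|a - A| < e /\ `|iter n T a + A| < e.
Proof.
move=> Tl [x dx] e0.
have orbit B : exists n, `|iter n T x - B| < e.
  have [||y [By [n _ Ty]]] := dx (ball B e).
  - by exists B; exact: ballxx.
  - exact: ball_open.
  by exists n; rewrite Ty; move: By; rewrite -ball_normE /= distrC.
have [n xA] := orbit A; have [m] := orbit (- A); rewrite opprK => xNA.
have [nm|/ltnW mn] := leqP n m.
  exists (m - n)%N, (iter n T x); split=> //.
  by rewrite -iterD subnK.
exists (n - m)%N, (- iter m T x).
have iterN k v : iter k T (- v) = - iter k T v.
  pose S : {linear V -> V} :=
    HB.pack (iter k T) (GRing.isLinear.Build R V V _ _ (iter_linear k Tl)).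
  exact: (linearN S).
by rewrite iterN -iterD subnK//; split; rewrite -?opprD ?normrN// addrC distrC.
Qed.

(** * Kitai's criterion at a fixed error and a fixed iterate *)

Definition kitai_approx (R : realType) (V : normedModType R) (S : V -> V)
    (e : R) (v : V) : Prop :=
  (exists2 p, `|p - v| <= e & `|S p| <= e) /\
  (exists2 q, `|q| <= e & `|S q - v| <= e).

Section KitaiApprox.
Context {R : realType} {V : normedModType R} (S : {linear V -> V}).

Lemma kitai_approx_le e1 e2 v :
  e1 <= e2 -> kitai_approx S e1 v -> kitai_approx S e2 v.
Proof.
move=> e12 [[p pv Sp] [q qe Sq]].
by split; [exists p|exists q]; apply: le_trans e12.
Qed.

Lemma kitai_approxZD e1 e2 c u v :
  kitai_approx S e1 u -> kitai_approx S e2 v ->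
  kitai_approx S (`|c| * e1 + e2) (c *: u + v).
Proof.
have combine (x y : V) : `|x| <= e1 -> `|y| <= e2 ->
    `|c *: x + y| <= `|c| * e1 + e2.
  move=> xe ye; rewrite (le_trans (ler_normD _ _))// lerD//.
  by rewrite normrZ ler_wpM2l.
move=> [[p pu Sp] [q qe Sq]] [[p' p'v Sp'] [q' q'e Sq']]; split.
  exists (c *: p + p'); last by rewrite linearP combine.
  by rewrite opprD addrACA -scalerBr combine.
exists (c *: q + q'); first by rewrite combine.
by rewrite linearP opprD addrACA -scalerBr combine.
Qed.

(** The empty sum has error exactly 0, so the inequalities in [kitai_approx] have to be
    non-strict. *)
Lemma kitai_approx_sum n (a : 'I_n -> R) (w : 'I_n -> V) e :
  (forall i, kitai_approx S e (w i)) ->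
  kitai_approx S ((\sum_(i < n) `|a i|) * e) (\sum_(i < n) a i *: w i).
Proof.
elim: n a w => [|n IHn] a w h.
  rewrite !big_ord0 mul0r.
  by split; exists 0; rewrite ?(linear0 S) ?subr0 normr0.
rewrite !big_ord_recl mulrDl; apply: kitai_approxZD => //.
exact: IHn.
Qed.

(** Take [x = p + q], where [p] is near [u'] and nearly killed by [S], while [q] is small and sent
    near [v']. The errors add up to less than e/4 + e/4 + e/2. *)
Lemma kitai_approx_transit e u v u' v' :
  `|u - u'| < e / 2 -> `|v - v'| < e / 2 ->
  kitai_approx S (e / 4) u' -> kitai_approx S (e / 4) v' ->
  exists x, `|x - u| < e /\ `|S x - v| < e.
Proof.
move=> uu' vv' [[p pu Sp] _] [_ [q qe Sq]]; exists (p + q).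
rewrite linearD; split.
  have -> : p + q - u = p - u' + q - (u - u').
    by rewrite opprB addrACA !addrA subrK addrAC.
  rewrite (le_lt_trans (ler_normB _ _))//.
  rewrite (le_lt_trans (lerD (ler_normD _ _) (lexx _)))//.
  lra.
have -> : S p + S q - v = S p + (S q - v') - (v - v').
  by rewrite opprB -!addrA; congr (_ + (_ + _)); rewrite addrA addNr add0r.
rewrite (le_lt_trans (ler_normB _ _))//.
rewrite (le_lt_trans (lerD (ler_normD _ _) (lexx _)))//.
lra.
Qed.

End KitaiApprox.

(** * The Lipschitz-free space and the operator [T_f] *)

Section FreeSpace.
Context {R : realType} {M : metricType R} (o : M).
Implicit Types (u v : freespace o) (g h : Lip0 o).

Lemma freeB_pair u v g : free_val (u - v) g = free_val u g - free_val v g.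
Proof. by []. Qed.

Lemma free_pair_le u g : `|free_val u g| <= `|u| * `|g|.
Proof. exact: opnormP. Qed.

Lemma delta_dist (x y : M) : `|delta o x - delta o y| <= mdist x y.
Proof.
apply: opnorm_le => [|g]; first exact: mdist_ge0.
by rewrite mulrC; exact: lipnormP.
Qed.

Lemma delta_base : delta o o = 0.
Proof. by apply/val_inj/dual_eqP => g; exact: Lip0_base. Qed.

(** The limit is built pointwise on [Lip0 o], shown to be a bounded functional, and then placed in
    the closed span by approximating it with members of the filter. *)
Lemma free_complete (F : set_system (freespace o)) :
  ProperFilter F -> cauchy F -> cvg F.
Proof.
move=> FF Fcauchy; have Fc : cauchy_ex F by exact: (proj1 (cauchyP F)) Fcauchy.
have near_pt e : 0 < e -> exists v, \forall u \near F, `|v - u| < e.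
  by move=> /Fc[v Fv]; exists v; move: Fv; rewrite -ball_normE.
pose phi g := lim (free_val u g @[u --> F]).
have phi_cvg g : free_val u g @[u --> F] --> phi g.
  apply: (@cauchy_cvg R); apply: cauchy_exP => e e0.
  have [|v Fv] := near_pt (e / (`|g| + 1)).
    by rewrite divr_gt0// ltr_wpDl.
  exists (free_val v g); rewrite -ball_normE /=; apply: filterS Fv => u /=.
  rewrite ltr_pdivlMr ?ltr_wpDl// => vu; rewrite -freeB_pair.
  rewrite (le_lt_trans (free_pair_le _ _))// (le_lt_trans _ vu)//.
  by rewrite ler_wpM2l// lerDl.
(* Passing to the limit in [u] gives a bound uniform over the unit ball in [g], which upgrades
   pointwise convergence to norm convergence. *)
have phi_near v e : (\forall u \near F, `|v - u| < e) ->
    forall g, `|free_val v g - phi g| <= e * `|g|.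
  move=> Fv g.
  have cv : `|free_val v g - free_val u g| @[u --> F] -->
      `|free_val v g - phi g|.
    by apply: cvg_norm; apply: cvgB => //; exact: cvg_cst.
  rewrite -(cvg_lim _ cv)//; apply: limr_le.
    by apply/cvg_ex; eexists; exact: cv.
  apply: filterS Fv => u /ltW vu; rewrite -freeB_pair.
  by rewrite (le_trans (free_pair_le _ _))// ler_wpM2r.
have phi_lin : linear phi.
  move=> c g h; apply/cvg_lim => //.
  have -> : (fun u : freespace o => free_val u (c *: g + h)) =
      (fun u => c * free_val u g + free_val u h).
    by apply/funext => u; rewrite (dual_linear (free_val u)).
  by apply: cvgD => //; apply: cvgMr.
have phi_dual : phi \in @is_dual R (Lip0 o).
  apply/asboolP; split=> //.
  pose phi' : {linear Lip0 o -> R} :=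
    HB.pack phi (GRing.isLinear.Build R (Lip0 o) R _ _ phi_lin).
  apply: (@bounded_linear_continuous _ _ _ phi'); apply/bounded_funP => r.
  have [v Fv] := near_pt 1 ltr01.
  exists ((1 + `|v|) * r) => g gr /=.
  rewrite -(subrKC (free_val v g) (phi g)) (le_trans (ler_normD _ _))//.
  rewrite addrC [leRHS]mulrDl lerD//.
    by rewrite distrC (le_trans (phi_near _ _ Fv g))// ler_wpM2l.
  by rewrite (le_trans (free_pair_le _ _))// ler_wpM2l.
have phi_dist v e : 0 < e -> (\forall u \near F, `|v - u| < e) ->
    `|free_val v - CDual phi_dual| <= e.
  by move=> e0 Fv; apply: opnorm_le => [|g]; [exact: ltW|exact: phi_near].
have phi_free : CDual phi_dual \in @free_pred R M o.
  apply/asboolP/closure_normP => e e0.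
  have e20 : 0 < e / 2 by rewrite divr_gt0.
  have [v Fv] := near_pt _ e20.
  have /asboolP/closure_normP/(_ _ e20)[w sw vw] := free_valP v.
  exists w => //; rewrite -(subrKA (free_val v)) (le_lt_trans (ler_normD _ _))//.
  by rewrite [e]splitr ler_ltD// distrC phi_dist.
apply/cvg_ex; exists (Freespace phi_free); apply/cvgrPdist_lt => e e0.
have e20 : 0 < e / 2 by rewrite divr_gt0.
have [v Fv] := near_pt _ e20.
apply: filterS (Fv) => u vu.
rewrite -(subrKA v) (le_lt_trans (ler_normD _ _))// [e]splitr ler_ltD//.
by rewrite distrC; exact: phi_dist.
Qed.

HB.instance Definition _ :=
  Uniform_isComplete.Build (freespace o) free_complete.

Lemma free_separable : countable [set: M] ->
  exists D : seq (rat * nat) -> freespace o,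
    forall u (e : R), 0 < e -> exists s, `|u - D s| < e.
Proof.
move=> /countable_injP[k kinj].
pose h j := xget o [set x | k x = j].
have hk x : h (k x) = x.
  apply: kinj; rewrite ?inE//.
  by apply: (@xgetPex _ o [set y | k y = k x]); exists x.
pose D (s : seq (rat * nat)) : freespace o :=
  \sum_(q <- s) ratr q.1 *: delta o (h q.2).
exists D => u e e0.
have approx n (a : 'I_n -> R) (z : 'I_n -> M) d : 0 < d ->
    exists s, `|\sum_(i < n) a i *: delta o (z i) - D s| < d.
  elim: n a z d => [|n IHn] a z d d0.
    by exists [::]; rewrite big_ord0 /D big_nil subr0 normr0.
  have d20 : 0 < d / 2 by rewrite divr_gt0.
  have [s sd] :=
    IHn (fun i => a (lift ord0 i)) (fun i => z (lift ord0 i)) _ d20.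
  (* The [+ 1] keeps the divisor positive: the norm vanishes when the point is [o]. *)
  pose c := d / 2 / (`|delta o (z ord0)| + 1).
  have c0 : 0 < c by rewrite divr_gt0// ltr_wpDl.
  have [q] : exists q : rat, ratr q \in `](a ord0 - c), (a ord0 + c)[.
    by apply: rat_in_itvoo; rewrite ltrBlDr -addrA ltrDl addr_gt0.
  rewrite in_itv /= -ltr_distlC => aq.
  exists ((q, k (z ord0)) :: s).
  rewrite big_ord_recl /D big_cons /= hk opprD addrACA -scalerBl.
  rewrite (le_lt_trans (ler_normD _ _))// [d]splitr ler_ltD// normrZ.
  move: aq; rewrite /c ltr_pdivlMr ?ltr_wpDl// => /ltW; apply: le_trans.
  by rewrite ler_wpM2l// lerDl.
have e20 : 0 < e / 2 by rewrite divr_gt0.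
have [_ [n [a [w [dw ->]]]] uw] := lspan_delta_dense u e20.
have /choice[z zw] : forall i, exists x, delta o x = w i.
  by move=> i; have [x _ <-] := dw i; exists x.
have [s] := approx n a z _ e20; under eq_bigr do rewrite zw.
move=> sw; exists s.
rewrite -(subrKA (\sum_(i < n) a i *: w i)) (le_lt_trans (ler_normD _ _))//.
by rewrite [e]splitr ltrD.
Qed.

(** [linearization] is obtained by choice and does not compute; uniqueness identifies it with the
    restricted adjoint. *)
Lemma linearizationE (f : Lip0_self o) u :
  free_val (linearization f u) = adjoint f (free_val u).
Proof.
pose T (v : freespace o) : freespace o := Freespace (adjoint_free f v).
suff <- : T = linearization f by [].
have Tlin : linear T.
  by move=> a v w; apply/val_inj; rewrite /= -adjoint_linear.
apply: linearization_unique => //.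
- pose T' : {linear freespace o -> freespace o} :=
    HB.pack T (GRing.isLinear.Build R (freespace o) (freespace o) _ _ Tlin).
  apply: (@bounded_linear_continuous _ _ _ T'); apply/bounded_funP => r.
  have [k k0 ak] := adjoint_bounded f.
  by exists (k * r) => v vr; rewrite free_normE (le_trans (ak _))// ler_wpM2l.
- by move=> x; apply/val_inj; exact: adjoint_eval.
Qed.

(** Keeping [h] separate from [g] lets it carry its own Lipschitz bound, better than the one
    inherited from the constant of [f] to the power [n]. *)
Lemma iter_linearization_pair (f : Lip0_self o) n u g h :
  (forall x, h x = g (iter n f x)) ->
  free_val (iter n (linearization f) u) g = free_val u h.
Proof.
elim: n g h => [|n IHn] g h hg; first by congr (free_val u _); exact/Lip0_eqP.
by rewrite iterS linearizationE /= (IHn (precomp f g) h).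
Qed.

Lemma iter_linearization_delta (f : Lip0_self o) n x :
  iter n (linearization f) (delta o x) = delta o (iter n f x).
Proof.
have [_ _ Td] := linearizationP f.
by elim: n => [|n IHn] //=; rewrite IHn Td.
Qed.

(** The order of quantifiers matters: [F] and [C] come before [S] and [e], because targeting
    produces the iterate only after the finite set and the error are given. *)
Lemma lspan_kitai_approx v : lspan (range (delta o)) v ->
  exists (F : set M) (C : R), [/\ finite_set F, 0 <= C &
    forall (S : {linear freespace o -> freespace o}) e,
      (forall x, F x -> kitai_approx S e (delta o x)) ->
      kitai_approx S (C * e) v].
Proof.
move=> [n [a [w [dw ->]]]].
have /choice[z zw] : forall i, exists x, delta o x = w i.
  by move=> i; have [x _ <-] := dw i; exists x.
exists (range z), (\sum_(i < n) `|a i|); split.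
- exact: finite_image.
- exact: sumr_ge0.
- move=> S e h; apply: kitai_approx_sum => i; rewrite -zw.
  by apply: h; exists i.
Qed.

(** * From targeting to weak mixing *)

Section Targeting.
Variable f : Lip0_self o.
Let T := linearization f.

Lemma targeting_weakly_mixing : targeting f o -> weakly_mixing T.
Proof.
move=> ft U V oU [[a1 a2] Ua] oV [[b1 b2] Vb].
have [eU eU0 hU] := open_prod_norm oU Ua.
have [eV eV0 hV] := open_prod_norm oV Vb.
pose e := Num.min eU eV.
have e0 : 0 < e by rewrite lt_min eU0.
have e20 : 0 < e / 2 by rewrite divr_gt0.
have [a1' /lspan_kitai_approx[F1 [C1 [fF1 C10 k1]]] a1e] :=
  lspan_delta_dense a1 e20.
have [a2' /lspan_kitai_approx[F2 [C2 [fF2 C20 k2]]] a2e] :=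
  lspan_delta_dense a2 e20.
have [b1' /lspan_kitai_approx[F3 [C3 [fF3 C30 k3]]] b1e] :=
  lspan_delta_dense b1 e20.
have [b2' /lspan_kitai_approx[F4 [C4 [fF4 C40 k4]]] b2e] :=
  lspan_delta_dense b2 e20.
pose C := C1 + C2 + C3 + C4 + 1.
have C0 : 0 < C by rewrite /C; lra.
(* Each delta_x will be handled with error [d * 2], and [C * (d * 2) = e / 4] is what
   [kitai_approx_transit] accepts. One [n] serves all four vectors. *)
pose d := e / 8 / C.
have d0 : 0 < d by rewrite !divr_gt0.
have [|n n1 hn] := ft d (F1 `|` F2 `|` F3 `|` F4) d0.
  by rewrite !finite_setU.
have [Tl _ _] := linearizationP f.
pose S : {linear freespace o -> freespace o} := HB.pack (iter n T)
  (GRing.isLinear.Build R (freespace o) (freespace o) _ _ (iter_linear n Tl)).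
have Sd x : S (delta o x) = delta o (iter n f x).
  exact: iter_linearization_delta.
have approx x : (F1 `|` F2 `|` F3 `|` F4) x ->
    kitai_approx S (d * 2) (delta o x).
  move=> Fx; have [[u [u0 [ux u0o fu]]] [v [v0 [vv0 fv fv0]]]] := hn _ _ Fx Fx.
  split.
    (* Subtracting delta_u0 costs little, as [u0] is near [o] and delta_o = 0, and the image then
       has norm at most the distance between the images of [u] and [u0]. *)
    exists (delta o u - delta o u0).
      rewrite addrAC (le_trans (ler_normB _ _))// mulr2n mulrDr mulr1 lerD//.
        by rewrite (le_trans (delta_dist _ _))// ltW.
      rewrite -[delta o u0]subr0 -delta_base.
      by rewrite (le_trans (delta_dist _ _))// ltW.
    rewrite linearB !Sd (le_trans (delta_dist _ _))//; lra.
  exists (delta o v - delta o v0).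
    by rewrite (le_trans (delta_dist _ _))//; lra.
  rewrite linearB !Sd addrAC (le_trans (ler_normB _ _))//.
  rewrite mulr2n mulrDr mulr1 lerD//.
    by rewrite (le_trans (delta_dist _ _))// ltW.
  rewrite -[delta o (iter n f v0)]subr0 -delta_base.
  by rewrite (le_trans (delta_dist _ _))// ltW.
have mono C' (v : freespace o) : C' <= C ->
    kitai_approx S (C' * (d * 2)) v -> kitai_approx S (e / 4) v.
  have -> : e / 4 = C * (d * 2) by rewrite /d; field; rewrite gt_eqF.
  by move=> CC; apply: kitai_approx_le; rewrite ler_wpM2r// mulr_ge0// ltW.
have {}k1 : kitai_approx S (e / 4) a1'.
  by apply: (mono C1); [rewrite /C; lra|apply: k1 => x ?];
    apply: approx; do 3 left.
have {}k2 : kitai_approx S (e / 4) a2'.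
  by apply: (mono C2); [rewrite /C; lra|apply: k2 => x ?];
    apply: approx; do 2 left; right.
have {}k3 : kitai_approx S (e / 4) b1'.
  by apply: (mono C3); [rewrite /C; lra|apply: k3 => x ?];
    apply: approx; left; right.
have {}k4 : kitai_approx S (e / 4) b2'.
  by apply: (mono C4); [rewrite /C; lra|apply: k4 => x ?; apply: approx; right].
have [x1 [x1a Sx1]] := kitai_approx_transit a1e b1e k1 k3.
have [x2 [x2a Sx2]] := kitai_approx_transit a2e b2e k2 k4.
have ltU x : x < e -> x < eU by move/lt_le_trans; apply; rewrite ge_min lexx.
have ltV x : x < e -> x < eV.
  by move/lt_le_trans; apply; rewrite ge_min lexx orbT.
exists n, (S x1, S x2); split; last exact: hV (ltV _ Sx1) (ltV _ Sx2).
exists (x1, x2); first exact: hU (ltU _ x1a) (ltU _ x2a).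
exact: (iter_pair T n (x1, x2)).
Qed.

(** * From hypercyclicity to targeting under radial discreteness *)

Section Radial.
Variable K : R.
Hypothesis K1 : 1 <= K.
Hypothesis Krad : forall x y : M, x <> y -> mdist x o <= K * mdist x y.

(** Only pairs with [p] inside and [q] outside [P] matter, and for them r <= d(p, o) <= K d(p, q).
    As [r] is positive, [o] lies outside [P]. *)
Lemma radial_indicator (P : pred M) (r : R) : 0 < r ->
  (forall x, P x -> r <= mdist x o) ->
  exists2 g : Lip0 o, forall x, g x = (P x)%:R & `|g| <= K / r.
Proof.
move=> r0 Pr; have K0 : 0 < K by exact: lt_le_trans K1.
have lip x y : `|(P x)%:R - (P y)%:R| <= K / r * mdist x y.
  have sep (p q : M) : P p -> ~~ P q -> 1 <= K / r * mdist p q.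
    move=> Pp Pq; have pq : p <> q by move=> pq; rewrite pq (negbTE Pq) in Pp.
    rewrite mulrAC ler_pdivlMr// mul1r (le_trans (Pr _ Pp))//; exact: Krad.
  case Px: (P x); case Py: (P y);
    rewrite ?subrr ?subr0 ?sub0r ?normrN ?normr0 ?normr1.
  - by rewrite mulr_ge0 ?mdist_ge0// divr_ge0// ltW.
  - by apply: sep; rewrite ?Px ?Py.
  - by rewrite metric_sym; apply: sep; rewrite ?Px ?Py.
  - by rewrite mulr_ge0 ?mdist_ge0// divr_ge0// ltW.
have Pl : (fun x => (P x)%:R) \in lip0 o.
  apply/asboolP; split; last by exists (K / r).
  by case Po: (P o) => //; move: (Pr _ Po); rewrite mdistxx leNgt r0.
exists (MkLip0 Pl) => //; apply: lipnorm_le => //.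
by rewrite divr_ge0// ltW.
Qed.

Lemma near_opposite_preimage (s : seq M) (r : R) n (a : freespace o) z :
  0 < r -> r <= mdist z o ->
  `|a - \sum_(x <- s) delta o x| < r / (4 * K) ->
  `|iter n T a + \sum_(x <- s) delta o x| < r / (4 * K) ->
  z \in s \/ (exists2 x, x \in s & iter n f x = z) ->
  exists2 x, mdist x o < r & iter n f x = z.
Proof.
move=> r0 rz aA TaA zs; apply: contrapT => noz.
have K0 : 0 < K by exact: lt_le_trans K1.
have [|h hE hK] := @radial_indicator (pred1 z) r r0; first by move=> x /eqP->.
have [|g gE gK] := @radial_indicator (fun x => iter n f x == z) r r0.
  by move=> x /eqP xz; rewrite leNgt; apply/negP => xr; apply: noz; exists x.
set A := \sum_(x <- s) _ in aA TaA.
have AE (l : Lip0 o) : free_val A l = \sum_(x <- s) l x.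
  rewrite /A; elim: s {zs A aA TaA} => [|x s IHs]; first by rewrite !big_nil.
  by rewrite !big_cons -IHs.
have Tag : free_val (iter n T a) h = free_val a g.
  by apply: iter_linearization_pair => x; rewrite gE hE.
(* The tolerance [r / (4 * K)] is chosen so that its product with the Lipschitz bound [K / r] is
   1/4. *)
have small (u : freespace o) (l : Lip0 o) :
    `|u| < r / (4 * K) -> `|l| <= K / r ->
    `|free_val u l| <= 1 / 4.
  move=> ul lK; rewrite (le_trans (free_pair_le _ _))//.
  rewrite (@le_trans _ _ (r / (4 * K) * (K / r)))//.
    by rewrite ler_pM// ltW.
  by rewrite le_eqVlt; apply/orP; left; apply/eqP; field; rewrite !gt_eqF.
have := small _ _ aA gK; have := small _ _ TaA hK.
have -> : free_val (iter n T a + A) h = free_val a g + free_val A h.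
  by rewrite -Tag.
rewrite freeB_pair !AE !ler_norml => /andP[_ h1] /andP[g1 _].
have g0 : 0 <= \sum_(x <- s) g x by apply: sumr_ge0 => x _; rewrite gE.
have h0 : 0 <= \sum_(x <- s) h x by apply: sumr_ge0 => x _; rewrite hE.
(* The two estimates give A(g) + A(h) <= 1/2 with both terms nonnegative, so neither can reach 1. *)
suff : 1 <= \sum_(x <- s) g x \/ 1 <= \sum_(x <- s) h x by case=> ?; lra.
have mem (l : Lip0 o) x : x \in s -> (forall y, 0 <= l y) -> l x = 1 ->
    1 <= \sum_(x <- s) l x.
  move=> xs l0 lx; rewrite (big_rem x)//= lx lerDl; exact: sumr_ge0.
case: zs => [zs|[x xs xz]];
  [right; apply: (mem _ z)|left; apply: (mem _ x)] => //.
- by move=> y; rewrite hE.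
- by rewrite hE /= eqxx.
- by move=> y; rewrite gE.
- by rewrite gE xz eqxx.
Qed.

Lemma hypercyclic_targeting : hypercyclic T -> targeting f o.
Proof.
move=> Thc e F e0 /finite_seqP[s ->].
have fo n : iter n f o = o by elim: n => [|n /= ->] //; exact: Lip0_self_base.
(* If [F] contains no point other than [o], the fixed point itself is every witness. Otherwise [y0]
   will serve to exclude [n = 0]. *)
have [allo|/existsNP[y0 /not_implyP[y0s y0o]]] :=
  pselect (forall y, y \in s -> y = o).
  exists 1%N => // x y /= /allo-> /allo->.
  by split; exists o, o; rewrite /= Lip0_self_base mdistxx.
(* A radius at most [e] that also leaves every point of [F] other than [o] outside the open ball
   around [o]. *)
have [r [r0 re rs]] : exists r, [/\ 0 < r, r <= e &
    forall y, y \in s -> y <> o -> r <= mdist y o].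
  elim: s {y0s} => [|x s [r [r0 re rs]]]; first by exists e.
  have [xo|xo] := pselect (x = o).
    by exists r; split=> // y; rewrite inE => /predU1P[-> //|]; exact: rs.
  exists (Num.min r (mdist x o)); split.
  - by rewrite lt_min r0 mdist_gt0; exact/eqP.
  - by rewrite ge_min re.
  - move=> y; rewrite inE ge_min => /predU1P[->|ys yo].
      by rewrite lexx orbT.
    by rewrite rs.
have [Tl _ _] := linearizationP f.
have K0 : 0 < K by exact: lt_le_trans K1.
have [|n [a [aA TaA]]] := @hypercyclic_to_opposite _ _ T
  (\sum_(x <- s) delta o x) (r / (4 * K)) Tl Thc.
  by rewrite divr_gt0// mulr_gt0.
have pre z (rz : r <= mdist z o) := near_opposite_preimage r0 rz aA TaA.
(* With [n = 0] the preimage of [y0] near [o] would be [y0] itself, which is at distance at least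
   [r]. *)
have n1 : (1 <= n)%N.
  rewrite lt0n; apply/eqP => n0; rewrite n0 in pre.
  have [|x xr xy] := pre _ (rs _ y0s y0o); first by left.
  by move: (rs _ y0s y0o); rewrite -xy leNgt xr.
exists n => // x y /= xs ys; split.
  (* For (i) take [u = x]. If its image is near [o], then [u0 = o] works; otherwise [u0] is another
     preimage of the same image, close to [o]. *)
  have [fxr|rfx] := ltP (mdist (iter n f x) o) r.
    by exists x, o; rewrite !mdistxx fo (lt_le_trans fxr).
  have [|z zr zx] := pre _ rfx; first by right; exists x.
  by exists x, z; rewrite zx !mdistxx (lt_le_trans zr).
have [->|yo] := pselect (y = o); first by exists o, o; rewrite fo mdistxx.
have [|z zr zy] := pre _ (rs _ ys yo); first by left.
by exists z, o; rewrite zy fo !mdistxx (lt_le_trans zr).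
Qed.

End Radial.
End Targeting.
End FreeSpace.

Theorem theorem4p11 (R : realType) (M : metricType R) (o : M)
    (f : Lip0_self o) (Mcountable : countable [set: M])
    (Mradial : radially_discrete o) :
  (hypercyclic (linearization f) <-> weakly_mixing (linearization f)) /\
  (weakly_mixing (linearization f) <-> targeting f o).
Proof.
have [K K1 Krad] := Mradial.
have wm_hc : weakly_mixing (linearization f) -> hypercyclic (linearization f).
  move=> /weakly_mixing_transitive.
  have [D denseD] := free_separable o Mcountable.
  by have [_ Tc _] := linearizationP f; exact: birkhoff_transitivity denseD Tc.
have hc_tg := hypercyclic_targeting K1 Krad (f := f).
have tg_wm := @targeting_weakly_mixing _ _ _ f.
by split; split; auto.
Qed.
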